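(* Let $G$ be a countable group. Every probability measure preserving action of $G$ on a diffuse probability space is weakly equivalent to a probability measure preserving action of $G$ on a standard probability space.
   Context: A probability measure preserving (pmp) action $a$ of a countable group $G$ is an action of $G$ by measure preserving automorphisms of a probability space $(\mathfrak{X}_a,\mu_a)$, which is not assumed to be standard. A probability space is diffuse if it has no atoms. Let $a,b$ be pmp actions of $G$ on $(\mathfrak{X}_a,\mu_a)$ and $(\mathfrak{X}_b,\mu_b)$. The action $a$ is weakly contained in $b$, written $a\prec b$, if for every $\varepsilon>0$, every finite measurable partition $\{A_1,\ldots,A_n\}$ of $\mathfrak{X}_a$ and every finite subset $F\subset G$ there is a measurable partition $\{B_1,\ldots,B_n\}$ of $\mathfrak{X}_b$ such that $$\sum_{i,j\leq n}\sum_{f\in F}|\mu_a(A_i\cap fA_j)-\mu_b(B_i\cap fB_j)|<\varepsilon.$$ The actions $a$ and $b$ are weakly equivalent if $a\prec b$ and $b\prec a$. *)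

(* Defs.v *)
From HB Require Import structures.
From mathcomp Require Import all_boot all_order all_algebra.
From mathcomp Require Import finmap.
From mathcomp Require Import all_classical all_reals all_analysis.

Set Implicit Arguments.
Unset Strict Implicit.
Unset Printing Implicit Defensive.

Import Order.TTheory GRing.Theory Num.Theory.
Import numFieldNormedType.Exports.

Local Open Scope classical_set_scope.
Local Open Scope ring_scope.

Record pmp_action (G : groupType) (R : realType) (d : measure_display)
    (X : measurableType d) (mu : probability X R) := PmpAction {
  act :> G -> X -> X ;
  act1 : forall x : X, act 1%g x = x ;
  actM : forall (g h : G) (x : X), act (g * h)%g x = act g (act h x) ;
  measurable_act : forall g : G, measurable_fun [set: X] (act g) ;
  act_preserving : forall (g : G) (A : set X),
    measurable A -> mu (act g @^-1` A) = mu A }.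

Section ProbabilitySpaces.
Context {R : realType} {d : measure_display} {X : measurableType d}.

Definition atom (mu : probability X R) (A : set X) : Prop :=
  [/\ measurable A, (0 < mu A)%E &
      forall B : set X, measurable B -> B `<=` A -> mu B = 0%E \/ mu B = mu A].

Definition diffuse (mu : probability X R) : Prop :=
  forall A : set X, ~ atom mu A.

(* As usual for partitions of a measure space, pieces may be empty. *)
Definition measurable_partition (n : nat) (A : 'I_n -> set X) : Prop :=
  [/\ forall i : 'I_n, measurable (A i), trivIset [set: 'I_n] A &
      \bigcup_i A i = [set: X]].

End ProbabilitySpaces.

(* A complete pseudometric space that is Hausdorff is a complete metric space,
   so [polish] says: separable complete metric space. *)
Definition polish (R : realType) (P : completePseudoMetricType R) : Prop :=
  hausdorff_space P /\ exists2 D : set P, countable D & dense D.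

(* The sigma-algebra of [X] is the Borel sigma-algebra of some Polish
   topology; [phi] identifies the points of [X] with those of the Polish
   space. A probability space is standard when its underlying measurable space
   is standard Borel; the measure is not required to be complete or diffuse. *)
Definition standard_borel (R : realType) (d : measure_display)
    (X : measurableType d) : Prop :=
  exists (P : completePseudoMetricType R) (phi : X -> P),
    [/\ polish P, bijective phi &
        forall A : set X, measurable A <-> <<s @open P >> (phi @` A)].

Section WeakContainment.
Context {G : groupType} {R : realType}.

Definition weakly_contained
    (d : measure_display) (X : measurableType d) (mu : probability X R)
    (d' : measure_display) (Y : measurableType d') (nu : probability Y R)
    (a : pmp_action G mu) (b : pmp_action G nu) : Prop :=
  forall eps : R, 0 < eps ->
  forall (n : nat) (A : 'I_n -> set X), measurable_partition A ->
  forall F : {fset G},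
  exists2 B : 'I_n -> set Y, measurable_partition B &
    \sum_(i < n) \sum_(j < n) \sum_(f <- F)
      `|fine (mu (A i `&` a f @` A j)) - fine (nu (B i `&` b f @` B j))| < eps.

Definition weakly_equivalent
    (d : measure_display) (X : measurableType d) (mu : probability X R)
    (d' : measure_display) (Y : measurableType d') (nu : probability Y R)
    (a : pmp_action G mu) (b : pmp_action G nu) : Prop :=
  weakly_contained a b /\ weakly_contained b a.

End WeakContainment.

(* Main.v *)
(* For every n, the matrices mu (A i :&: g A j) of the n-piece partitions of X
   lie in a separable space, so countably many partitions of X realise them all
   up to any error. Record in which piece of which of these partitions each
   translate of x falls: this itinerary of x is a point of the Baire space, and
   the map to itineraries intertwines the given action with a shift. The image
   measure makes the shift a factor, hence weakly contained in the given action;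
   conversely the chosen partitions are pulled back from the shift, so the shift
   weakly contains the given action. *)
Require Import Defs.
From HB Require Import structures.
From mathcomp Require Import all_boot all_order all_algebra.
From mathcomp Require Import finmap.
From mathcomp Require Import all_classical all_reals all_analysis.

Set Implicit Arguments.
Unset Strict Implicit.
Unset Printing Implicit Defensive.

Import Order.TTheory GRing.Theory Num.Theory.
Import numFieldNormedType.Exports.

Local Open Scope classical_set_scope.
Local Open Scope ring_scope.

(* [R] only fixes the field in which distances take their values. *)
Definition baire (R : realType) : Type := nat -> nat.

HB.instance Definition _ (R : realType) :=
  Choice.copy (baire R) {classic nat -> nat}.
HB.instance Definition _ (R : realType) :=
  isPointed.Build (baire R) (fun=> 0%N).

(** * Topology of the Baire space *)

Section BaireSpace.
Context {R : realType}.
Implicit Types x y z : baire R.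

(* The distance is [1 / n.+1], where [n] is the first place of disagreement. *)
Definition baire_ball x (r : R) : set (baire R) :=
  [set y | 0 < r /\ forall n : nat, r * n.+1%:R <= 1 -> x n = y n].

Definition baire_entourage : set_system (baire R * baire R) :=
  entourage_ baire_ball.

HB.instance Definition _ := hasNbhs.Build (baire R) (nbhs_ baire_entourage).

Let ball_center x (r : R) : 0 < r -> baire_ball x r x.
Proof. by []. Qed.

Let ball_sym x y (r : R) : baire_ball x r y -> baire_ball y r x.
Proof. by move=> [r0 xy]; split=> // n rn; rewrite xy. Qed.

Let ball_triangle x y z (r s : R) :
  baire_ball x r y -> baire_ball y s z -> baire_ball x (r + s) z.
Proof.
move=> [r0 xy] [s0 yz]; split=> [|n rsn]; first exact: addr_gt0.
(* Places compared at radius [r + s] are compared at [r] and at [s] too; positivity of the radii,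
   built into the ball, makes both smaller. *)
rewrite xy ?yz//; apply: le_trans rsn; rewrite ler_pM2r ?ltr0n//.
  by rewrite lerDr ltW.
by rewrite lerDl ltW.
Qed.

HB.instance Definition _ := @Nbhs_isPseudoMetric.Build R (baire R)
  baire_entourage erefl baire_ball ball_center ball_sym ball_triangle erefl.

Lemma baire_ball_prefix n x y :
  ball x (n.+1%:R^-1 : R) y <-> forall m, (m <= n)%N -> x m = y m.
Proof.
split=> [[_ xy] m mn|xy].
  by apply: xy; rewrite ler_pdivrMl ?ltr0n// mulr1 ler_nat.
split=> [|m]; first by rewrite invr_gt0 ltr0n.
by rewrite ler_pdivrMl ?ltr0n// mulr1 ler_nat => /xy.
Qed.

Lemma baire_ball_sub x (r : R) : 0 < r ->
  exists n, ball x (n.+1%:R^-1 : R) `<=` ball x r.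
Proof.
move=> r0; exists (Num.truncn r^-1); apply: le_ball.
rewrite invf_ple ?posrE// ?ltr0n//.
by apply/ltW/truncnS_gt.
Qed.

Lemma baire_nbhsP x (A : set (baire R)) :
  nbhs x A <-> exists n, ball x (n.+1%:R^-1 : R) `<=` A.
Proof.
split=> [/nbhs_ballP[r /= r0 rA]|[n nA]].
  have [n nr] := baire_ball_sub x r0; exists n; exact: subset_trans rA.
by apply/nbhs_ballP; exists n.+1%:R^-1 => //=; rewrite invr_gt0 ltr0n.
Qed.

Lemma baire_hausdorff : hausdorff_space (baire R).
Proof.
rewrite ball_hausdorff => x y xy.
suff [n xyn] : exists n, x n <> y n.
  have n0 : 0 < n.+1%:R^-1 :> R by rewrite invr_gt0 ltr0n.
  exists (PosNum n0, PosNum n0) => /=; apply/eqP/seteqP; split=> // z [].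
  move=> /baire_ball_prefix/(_ n (leqnn n)) xz.
  by move=> /baire_ball_prefix/(_ n (leqnn n)) yz; apply: xyn; rewrite xz yz.
by apply/existsNP => eqxy; move/eqP: xy; apply; apply/funext.
Qed.

Let baire_complete (F : set_system (baire R)) :
  ProperFilter F -> cauchy F -> cvg F.
Proof.
move=> FF /cauchyP Fc.
have /choice[s Fs] n : exists x : baire R, F (ball x (n.+1%:R^-1 : R)).
  by apply: Fc; rewrite invr_gt0 ltr0n.
(* The limit is diagonal: its place [n] is read off the centre [s n] of a ball of radius [1 / n.+1]
   that belongs to [F]. *)
apply/cvg_ex; exists (fun n => s n n : nat); apply/fcvg_ballP => r r0.
set l : baire R := fun n => _.
have [n nr] := baire_ball_sub l r0.
have : F [set y | forall m : 'I_n.+1, ball (s m) (m.+1%:R^-1 : R) y].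
  by apply: filter_forall => m; exact: Fs.
apply: filterS => y sy; apply/nr/baire_ball_prefix => m mn.
by have /baire_ball_prefix/(_ m (leqnn m)) := sy (Ordinal (mn : (m < n.+1)%N)).
Qed.

HB.instance Definition _ := Uniform_isComplete.Build (baire R) baire_complete.

Definition finitely_supported (s : seq nat) : baire R := nth 0%N s.

Lemma baire_ball_finitely_supported x n :
  ball x (n.+1%:R^-1 : R) (finitely_supported (mkseq x n.+1)).
Proof.
by apply/baire_ball_prefix => m mn; rewrite /finitely_supported nth_mkseq.
Qed.

Lemma baire_polish : polish (baire R).
Proof.
split; first exact: baire_hausdorff.
exists (range finitely_supported).
  exact: sub_countable (card_image_le _ _) (countableP _).
move=> U [x Ux]; rewrite openE => /(_ x Ux)/baire_nbhsP[n xnU].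
exists (finitely_supported (mkseq x n.+1)); split; last by eexists.
exact/xnU/baire_ball_finitely_supported.
Qed.

End BaireSpace.

Definition baire_borel (R : realType) := g_sigma_algebraType (@open (baire R)).

Lemma baire_standard_borel (R : realType) : standard_borel R (baire_borel R).
Proof.
exists (baire R : completePseudoMetricType R), id; split.
- exact: baire_polish.
- by exists id.
- by move=> A; rewrite image_id.
Qed.

Lemma measurable_coordinate (R : realType) (n : nat) (P : set nat) :
  measurable [set y : baire_borel R | P (y n)].
Proof.
apply: sub_sigma_algebra; rewrite openE => y Py.
by apply/baire_nbhsP; exists n => z /baire_ball_prefix/(_ n (leqnn n)) /= <-.
Qed.

(** The topology has a countable base whose sets each constrain finitely many coordinates, so
    measurability can be tested coordinatewise. *)
Lemma measurable_fun_baire (R : realType) (d : measure_display)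
    (X : measurableType d) (f : X -> baire_borel R) :
  (forall n i, measurable [set x | f x n = i]) -> measurable_fun [set: X] f.
Proof.
move=> mf.
apply: (@measurability _ _ X (baire_borel R) setT f (@open (baire R))) => //.
move=> _ [U oU <-].
rewrite setTI.
(* Only countably many balls have a finitely supported centre, and every open
   set is a union of such balls. *)
pose V (p : nat * seq nat) : set (baire R) :=
  ball (finitely_supported p.2 : baire R) (p.1.+1%:R^-1 : R).
have -> : f @^-1` U =
    \bigcup_(p in [set p | V p `<=` U]) (f @^-1` V p).
  apply/seteqP; split=> [x Ux|x [p pU xp]]; last exact: pU.
  move: oU; rewrite openE => /(_ _ Ux)/baire_nbhsP[n xnU].
  exists (n, mkseq (f x) n.+1) => /=; last first.
    exact/ball_sym/baire_ball_finitely_supported.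
  move=> z /baire_ball_prefix Vz; apply: xnU; apply/baire_ball_prefix => m mn.
  by rewrite -Vz// /finitely_supported nth_mkseq.
rewrite bigcup_mkcond; apply: countable_bigcupT_measurable => // p.
case: ifP => // _.
have -> : f @^-1` V p =
    \bigcap_(m in `I_p.1.+1) [set x | f x m = nth 0%N p.2 m].
  by apply/seteqP; split=> x => [/baire_ball_prefix xp m mp|xp];
    [rewrite /= -xp|apply/baire_ball_prefix => m mp; rewrite xp].
by apply: bigcap_measurableType => m _; exact: mf.
Qed.

(** * Countable approximation and labelled partitions *)

(** Separability for pointwise convergence. A code lists finitely many rational targets and a
    precision; it suffices to pick, for each code that can be met, one [t] that meets it. *)
Lemma countable_approximation (R : realType) (I : countType) (T : Type)
    (v : T -> I -> R) (t0 : T) :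
  exists s : nat -> T, forall (t : T) (J : seq I) (eps : R), 0 < eps ->
    exists k, forall i, i \in J -> `|v t i - v (s k) i| < eps.
Proof.
pose close (c : seq (I * rat) * nat) t :=
  forall p, p \in c.1 -> `|v t p.1 - ratr p.2| < c.2.+1%:R^-1.
have /choice[s sP] c : exists t, (exists t', close c t') -> close c t.
  have [[t ct]|nc] := pselect (exists t, close c t); first by exists t.
  by exists t0 => /nc.
exists (fun k => if choice.unpickle k is Some c then s c else t0).
move=> t J eps eps0.
(* Half of [eps] for each of the two distances to a common rational target. *)
pose m := Num.truncn (eps / 2)^-1.
have m0 : 0 < m.+1%:R^-1 :> R by rewrite invr_gt0 ltr0n.
have meps : m.+1%:R^-1 < eps / 2.
  by rewrite invf_plt ?posrE ?ltr0n ?divr_gt0// truncnS_gt.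
have /choice[q qP] i : exists q : rat, `|v t i - ratr q| < m.+1%:R^-1.
  have /rat_in_itvoo[q] : v t i - m.+1%:R^-1 < v t i + m.+1%:R^-1.
    by rewrite ltrD2l gtrN.
  by rewrite in_itv /= => tq; exists q; rewrite ltr_distlC.
pose c := ([seq (i, q i) | i <- J], m).
have tc : close c t by move=> p /mapP[i _ ->]; exact: qP.
exists (choice.pickle c) => i iJ; rewrite choice.pickleK.
have sc : `|v (s c) i - ratr (q i)| < m.+1%:R^-1.
  by apply: (sP c (ex_intro _ t tc) (i, q i)); exact: map_f.
rewrite (le_lt_trans (ler_distD (ratr (q i)) _ _))// [eps]splitr.
by rewrite ltrD// (lt_trans _ meps)// distrC.
Qed.

(** Labels turn a partition into a function, whose values an itinerary can record. *)
Lemma measurable_partition_label (d : measure_display)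
    (X : measurableType d) (n : nat) (A : 'I_n -> set X) :
  measurable_partition A ->
  exists l : X -> 'I_n, forall i, l @^-1` [set i] = A i.
Proof.
move=> [_ tA cA].
have /choice[l lP] x : exists i, A i x.
  by have [i _] : (\bigcup_i A i) x by [rewrite cA]; exists i.
exists l => i; apply/seteqP; split=> x /= => [<-|Ax]; first exact: lP.
by apply: (tA (l x) i) => //; exists x; split.
Qed.

Lemma label_measurable_partition (d : measure_display)
    (X : measurableType d) (n : nat) (l : X -> 'I_n) :
  (forall i, measurable (l @^-1` [set i])) ->
  measurable_partition (fun i => l @^-1` [set i]).
Proof.
move=> ml; split=> //; first by move=> i j _ _ [x [<- <-]].
by apply/seteqP; split=> // x _; exists (l x).
Qed.

(** * Correlations and weak containment *)

Section PmpActions.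
Context {G : groupType} {R : realType}.

Section Translates.
Context {d : measure_display} {X : measurableType d} {mu : probability X R}.
Variable a : pmp_action G mu.

Lemma act_image (g : G) (A : set X) : a g @` A = a g^-1%g @^-1` A.
Proof.
apply/seteqP; split=> [_ [x Ax <-]|x Ax] /=.
  by rewrite -actM mulVg act1.
by exists (a g^-1%g x); rewrite // -actM mulgV act1.
Qed.

Lemma measurable_act_image (g : G) (A : set X) :
  measurable A -> measurable (a g @` A).
Proof.
move=> mA; rewrite act_image -[X in measurable X]setTI.
exact: measurable_act.
Qed.

Definition correlation (n : nat) (A : 'I_n -> set X) (i j : 'I_n) (g : G) : R :=
  fine (mu (A i `&` a g @` A j)).

End Translates.

Section TwoActions.
Context {d : measure_display} {X : measurableType d} {mu : probability X R}.
Context {d' : measure_display} {Y : measurableType d'} {nu : probability Y R}.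
Variables (a : pmp_action G mu) (b : pmp_action G nu).

Lemma weakly_contained_of_close :
  (forall n (A : 'I_n -> set X), measurable_partition A ->
   forall (F : {fset G}) (eps : R), 0 < eps ->
   exists2 B : 'I_n -> set Y, measurable_partition B &
     forall i j f, f \in F ->
       `|correlation a A i j f - correlation b B i j f| < eps) ->
  weakly_contained a b.
Proof.
move=> close eps eps0 n A mA F.
(* The sum has [N] terms; the bound [eps / N.+1] on each keeps it strictly below [eps], even when it
   is empty. *)
pose N := (size F * n * n)%N.
have epsN : 0 < eps / N.+1%:R by rewrite divr_gt0// ltr0n.
have [B mB AB] := close n A mA F _ epsN.
exists B => //.
apply: (@le_lt_trans _ _
  (\sum_(i < n) \sum_(j < n) \sum_(f <- F) (eps / N.+1%:R))).
  apply: ler_sum => i _; apply: ler_sum => j _.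
  by rewrite !big_seq; apply: ler_sum => f fF; exact/ltW/AB.
rewrite !sumr_const !card_ord big_const_seq count_predT iter_addr_0 -!mulrnA.
rewrite -[ltLHS]mulr_natr mulrAC ltr_pdivrMr ?ltr0n// ltr_pM2l// ltr_nat.
by rewrite mulnA.
Qed.

Variable phi : X -> Y.
Hypothesis phi_act : forall g x, phi (a g x) = b g (phi x).
Hypothesis measurable_phi : measurable_fun [set: X] phi.
Hypothesis phi_mu : forall A, measurable A -> nu A = mu (phi @^-1` A).

Lemma correlation_factor (n : nat) (B : 'I_n -> set Y) (i j : 'I_n) (g : G) :
  (forall i, measurable (B i)) ->
  correlation b B i j g = correlation a (fun i => phi @^-1` B i) i j g.
Proof.
move=> mB; rewrite /correlation phi_mu.
  by rewrite !act_image; congr (fine (mu _)); apply/seteqP; split=> x /=;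
    rewrite phi_act.
by apply: measurableI => //; exact: measurable_act_image.
Qed.

(** Partitions pulled back along a factor map keep their correlations exactly, so every term of the
    sum vanishes. *)
Lemma weakly_contained_factor : weakly_contained b a.
Proof.
move=> eps eps0 n B mB F; exists (fun i => phi @^-1` B i).
  have [mBi tB cB] := mB; split=> [i|i j _ _ [x [Bi Bj]]|].
  - by rewrite -[X in measurable X]setTI; exact: measurable_phi.
  - by apply: (tB i j) => //; exists (phi x).
  - by rewrite -preimage_bigcup cB preimage_setT.
have [mBi _ _] := mB.
rewrite big1// => i _; rewrite big1// => j _; rewrite big1// => f _.
have := correlation_factor i j f mBi; rewrite /correlation => ->.
by rewrite subrr normr0.
Qed.

End TwoActions.

(** * Itineraries and the shift *)

Section Itineraries.
Context {K : Type} (e : G * K -> nat) (q : nat -> option (G * K)).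
Hypothesis qP : forall m p, q m = Some p <-> e p = m.

Let qe p : q (e p) = Some p.
Proof. exact/qP. Qed.

(** In an itinerary, coordinate [e (h, k)] holds the [k]-th label of the translate by [h], so moving
    the point by [g] replaces [h] by [h * g]; right multiplication gives a left action. Coordinates
    that code no pair stay fixed. *)
Definition shift (g : G) (y : baire_borel R) : baire_borel R :=
  fun m => if q m is Some (h, k) then y (e ((h * g)%g, k)) else y m.

Lemma shift1 y : shift 1%g y = y.
Proof.
by apply/funext => m; rewrite /shift; case qm: (q m) => [[h k]|//];
  rewrite mulg1; congr (y _); exact/qP.
Qed.

Lemma shiftM g h y : shift (g * h)%g y = shift g (shift h y).
Proof.
apply/funext => m; rewrite /shift; case: (q m) => [[l k]|//].
by rewrite qe mulgA.
Qed.

Lemma measurable_shift g : measurable_fun [set: baire_borel R] (shift g).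
Proof.
apply: measurable_fun_baire => m i; rewrite /shift.
case: (q m) => [[h k]|]; last exact: (measurable_coordinate m [set i]).
exact: (measurable_coordinate _ [set i]).
Qed.

Context {d : measure_display} {X : measurableType d} {mu : probability X R}.
Variables (a : pmp_action G mu) (c : K -> X -> nat).
Hypothesis measurable_c : forall k i, measurable [set x | c k x = i].

Definition itinerary (x : X) : baire_borel R :=
  fun m => if q m is Some (h, k) then c k (a h x) else 0%N.

Lemma itinerary_act g x : itinerary (a g x) = shift g (itinerary x).
Proof.
apply/funext => m; rewrite /itinerary /shift; case: (q m) => [[h k]|//].
by rewrite qe actM.
Qed.

(** Reading at the identity recovers each label function, which is how chosen partitions are pulled
    back from the shift. *)
Lemma itinerary_coordinate k x : itinerary x (e (1%g, k)) = c k x.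
Proof. by rewrite /itinerary qe act1. Qed.

Lemma measurable_itinerary : measurable_fun [set: X] itinerary.
Proof.
apply: measurable_fun_baire => m i; rewrite /itinerary.
case: (q m) => [[h k]|].
  rewrite -[X in measurable X]setTI.
  exact: (measurable_act a h measurableT (measurable_c k i)).
(* A place that codes no pair always carries [0], so the set is everything or empty. *)
by have [->|i0] := eqVneq i 0%N;
  [rewrite (_ : [set _ | _] = setT)|rewrite (_ : [set _ | _] = set0)] => //;
  apply/seteqP; split=> // x /= ie; rewrite -ie eqxx in i0.
Qed.

End Itineraries.

(** The image of [mu] under the itinerary map is shift invariant by equivariance; [z k] codes the
    identity paired with [k]. *)
Lemma itinerary_factor (d : measure_display) (X : measurableType d)
    (mu : probability X R) (a : pmp_action G mu) (K : countType)
    (c : K -> X -> nat) :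
  countable [set: G] -> (forall k i, measurable [set x | c k x = i]) ->
  exists (nu : probability (baire_borel R) R) (b : pmp_action G nu)
    (phi : X -> baire_borel R) (z : K -> nat),
    [/\ forall g x, phi (a g x) = b g (phi x),
        measurable_fun [set: X] phi,
        forall A, measurable A -> nu A = mu (phi @^-1` A) &
        forall k x, phi x (z k) = c k x].
Proof.
move=> /countable_injP[code /in2TT code_inj] mc.
pose e (p : G * K) := choice.pickle (code p.1, p.2).
have e_inj : injective e.
  move=> [g k] [h l] /(pcan_inj choice.pickleK)/= gkhl.
  by have [/code_inj -> ->] := gkhl.
have /choice[q qP] m : exists o, forall p, o = Some p <-> e p = m.
  have [[p pm]|nm] := pselect (exists p, e p = m).
    exists (Some p) => r; split=> [[<-]//|rm].
    by congr Some; apply: e_inj; rewrite pm.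
  by exists None => p; split=> // pm; case: nm; exists p.
have mphi := measurable_itinerary q a mc.
pose Phi : {mfun X >-> baire_borel R} :=
  HB.pack (itinerary q a c) (isMeasurableFun.Build _ _ _ _ _ mphi).
pose nu : probability (baire_borel R) R := distribution mu Phi.
have shift_nu g A : measurable A -> nu (shift e q g @^-1` A) = nu A.
  move=> mA; rewrite /nu /= /distribution /pushforward /=.
  rewrite -[RHS](act_preserving a g); last first.
    by rewrite -[X in measurable X]setTI; exact: (mphi _ A).
  by congr (mu _); apply/seteqP; split=> x /=; rewrite (itinerary_act qP).
pose b : pmp_action G nu := PmpAction (shift1 qP) (shiftM qP)
  (measurable_shift e q) shift_nu.
exists nu, b, (itinerary q a c), (fun k => e (1%g, k)); split=> //.
- by move=> g x; exact: itinerary_act.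
- by move=> k x; exact: itinerary_coordinate.
Qed.

(** * A countable dense family of partitions *)

(** Correlations of a partition form a countable family of reals, so countable approximation
    applies. With [n.+1] labels a constant label function exists and serves as the default. *)
Lemma countable_dense_labels (d : measure_display) (X : measurableType d)
    (mu : probability X R) (a : pmp_action G mu) (n : nat) :
  countable [set: G] ->
  exists s : nat -> X -> 'I_n.+1,
    (forall k i, measurable (s k @^-1` [set i])) /\
    forall (A : 'I_n.+1 -> set X), measurable_partition A ->
    forall (F : {fset G}) (eps : R), 0 < eps ->
    exists k, forall i j f, f \in F ->
      `|correlation a A i j f -
        correlation a (fun i => s k @^-1` [set i]) i j f| < eps.
Proof.
move=> /countable_injP[code /in2TT code_inj].
(* Group elements are indexed by their codes in [nat]; numbers that code nothing decode to the
   identity. *)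
have /choice[decode decodeP] m : exists g, forall h, code h = m -> g = h.
  have [[g gm]|nm] := pselect (exists g, code g = m).
    by exists g => h hm; apply: code_inj; rewrite gm.
  by exists 1%g => h hm; case: nm; exists h.
pose T := {l : X -> 'I_n.+1 | forall i, measurable (l @^-1` [set i])}.
have l0 : forall i, measurable ((fun=> ord0 : 'I_n.+1) @^-1` [set i] : set X).
  by move=> i; rewrite preimage_cst; case: ifP.
pose v (t : T) (p : 'I_n.+1 * 'I_n.+1 * nat) :=
  correlation a (fun i => sval t @^-1` [set i]) p.1.1 p.1.2 (decode p.2).
have [s sP] := countable_approximation v (exist _ _ l0).
exists (fun k => sval (s k)); split=> [k|A]; first exact: (svalP (s k)).
move=> mA F eps eps0; have [l lA] := measurable_partition_label mA.
have ml i : measurable (l @^-1` [set i]) by rewrite lA; case: mA.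
pose J := [seq (p, m) | p <- enum {: 'I_n.+1 * 'I_n.+1}, m <- map code F].
have [k kP] := sP (exist _ l ml) J eps eps0.
exists k => i j f fF.
have /kP : (i, j, code f) \in J.
  by apply: allpairs_f; rewrite ?mem_enum//; exact: map_f.
rewrite /v /= (decodeP _ f)//.
by congr (`|_ - _| < _); rewrite /correlation !lA.
Qed.

End PmpActions.

Theorem theorem1 (R : realType) (G : groupType) (G_countable : countable [set: G])
    (d : measure_display) (X : measurableType d) (mu : probability X R)
    (mu_diffuse : diffuse mu) (a : pmp_action G mu) :
  exists (d' : measure_display) (Y : measurableType d') (nu : probability Y R)
    (b : pmp_action G nu),
    standard_borel R Y /\ weakly_equivalent a b.
Proof.
pose labels n := cid (countable_dense_labels a n G_countable).
pose s n := sval (labels n).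
(* All sizes are recorded together: [p.1.+1] is the number of pieces, [p.2] selects the
   partition. *)
pose c (p : nat * nat) x : nat := s p.1 p.2 x.
have mc p i : measurable [set x | c p x = i].
  have [ip|pi] := ltnP i p.1.+1.
    rewrite (_ : [set _ | _] = s p.1 p.2 @^-1` [set Ordinal ip]).
      exact: (svalP (labels p.1)).1.
    by apply/seteqP; split=> x;
      [move=> xi; exact: val_inj|rewrite /= /c => ->].
  rewrite (_ : [set _ | _] = set0)//; apply/seteqP; split=> // x /= xi.
  by move: pi; rewrite -xi leqNgt ltn_ord.
have [nu [b [phi [z [phi_act mphi phi_mu zP]]]]] :=
  itinerary_factor a G_countable mc.
exists _, (baire_borel R), nu, b; split; first exact: baire_standard_borel.
split; last exact: weakly_contained_factor phi_act mphi phi_mu.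
apply: weakly_contained_of_close => -[|n] A mA F eps eps0.
  (* Zero pieces cannot cover [X], which has measure [1]. *)
  have [_ _ A0] := mA; exfalso.
  have := @probability_setT _ _ _ mu; rewrite -A0 bigcup0 => [|[]//].
  by rewrite measure0 => /eqP; rewrite eqe eq_sym oner_eq0.
have [k kP] := (svalP (labels n)).2 A mA F eps eps0.
(* On itineraries this reads back the label [s n k]; elsewhere [inord] sends out-of-range entries to
   a default, so [l] labels every sequence. *)
pose l (y : baire_borel R) : 'I_n.+1 := inord (y (z (n, k))).
have ml i : measurable (l @^-1` [set i]).
  exact: (measurable_coordinate (z (n, k)) [set m | inord m = i]).
exists (fun i => l @^-1` [set i]); first exact: label_measurable_partition.
move=> i j f fF; rewrite (correlation_factor phi_act phi_mu)//.
have -> : (fun i => phi @^-1` (l @^-1` [set i])) =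
    (fun i => s n k @^-1` [set i]).
  by apply/funext => i'; apply/seteqP; split=> x /=; rewrite /l zP inord_val.
exact: kP.
Qed.
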